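(* Let $\mathcal{H}$ be a complex Hilbert space with a dictionary $\mathcal{D}$, let $M>0$, and let $f\in\mathcal{H}(\mathcal{D},M)$. Let $(t_k)_{k\ge 1}$ be a sequence with $t_k\in(0,1]$, and let $\psi^{(o)}_1,\psi^{(o)}_2,\dots\in\mathcal{D}$ be a realization of the weak orthogonal greedy algorithm (WOGA) applied to $f$ with weakness sequence $(t_k)$, with remainders $f_1=f,f_2,f_3,\dots$. Put $v_k=\|\psi^{(o)}_k-P_{H_{k-1}}(\psi^{(o)}_k)\|$. Then for every $n\ge 1$, $$\|f_n\|\le M\Bigl(1+\sum_{k=1}^{n-1}\Bigl(\frac{t_k}{v_k}\Bigr)^2\Bigr)^{-1/2}.$$
   Context: A dictionary of $\mathcal{H}$ is a set $\mathcal{D}\subset\mathcal{H}$ with $\|\psi\|=1$ for all $\psi\in\mathcal{D}$ and $\overline{\operatorname{span}\mathcal{D}}=\mathcal{H}$. For $M>0$, $\mathcal{H}(\mathcal{D},M)$ is the set of $f\in\mathcal{H}$ for which there exist $\tilde\psi_k\in\mathcal{D}$ and $c_k\in\mathbb{C}$, $k=1,2,\dots$, with $f=\sum_{k=1}^\infty c_k\tilde\psi_k$ and $\sum_{k=1}^\infty|c_k|\le M$. WOGA: a realization for $f$ with weakness sequence $(t_k)$ is a sequence $\psi^{(o)}_1,\psi^{(o)}_2,\dots\in\mathcal{D}$ built as follows. Set $H_0=\{0\}$, $H_{k}=\operatorname{span}\{\psi^{(o)}_1,\dots,\psi^{(o)}_{k}\}$, and let $P_{H_k}$ be the orthogonal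 projection onto $H_k$. Let $f_1=f$ and, for $k\ge1$, given $f_k$, choose $\psi^{(o)}_k\in\mathcal{D}$ with $$|\langle f_k,\psi^{(o)}_k\rangle|\ge t_k\sup_{\psi\in\mathcal{D}}|\langle f_k,\psi\rangle|.$$ (The existence of such selections is part of the hypothesis when $t_k=1$.) Put $$u_k=\frac{\psi^{(o)}_k-P_{H_{k-1}}(\psi^{(o)}_k)}{\|\psi^{(o)}_k-P_{H_{k-1}}(\psi^{(o)}_k)\|},\qquad f_{k+1}=f-\sum_{l=1}^{k}\langle f,u_l\rangle u_l .$$ Convention: the algorithm is run only while the remainder is nonzero, i.e. the bound is asserted for those $n$ such that $f_k\neq0$ for all $k<n$; then $v_k>0$ and $u_k$ is well defined for $k<n$. *)

(* Defs.v *)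
From mathcomp Require Import all_boot all_order all_algebra sesquilinear.
From mathcomp Require Import all_classical all_reals all_analysis.
From mathcomp Require Import complex.

Set Implicit Arguments.
Unset Strict Implicit.
Unset Printing Implicit Defensive.

Import Order.TTheory GRing.Theory Num.Theory Num.Def.
Import numFieldNormedType.Exports.

Local Open Scope classical_set_scope.
Local Open Scope complex_scope.
Local Open Scope ring_scope.

(* A complex Hilbert space is a completeNormedModType over R[i] together with
   a positive definite hermitian form ip (linear in the first argument and
   conjugate-linear in the second) that induces its norm. *)
Definition induces_norm (R : realType) (H : completeNormedModType R[i])
    (ip : {dot H for (conjC : R[i] -> R[i])}) : Prop :=
  forall x : H, `|x| ^+ 2 = ip x x.

(* Norms over R[i] take values in R[i]; normR is the same norm with values
   in R. *)
Definition normR (R : realType) (V : normedZmodType R[i]) (x : V) : R :=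
  complex.Re `|x|.

Definition lspan (K : numFieldType) (V : lmodType K) (A : set V) : set V :=
  [set x | exists (n : nat) (a : 'I_n -> K) (y : 'I_n -> V),
     (forall i, A (y i)) /\ x = \sum_(i < n) a i *: y i].

Definition dictionary (R : realType) (H : completeNormedModType R[i])
    (D : set H) : Prop :=
  (forall psi, D psi -> normR psi = 1) /\ closure (lspan D) = setT.

(* The class H(D, M). *)
Definition sparse_class (R : realType) (H : completeNormedModType R[i])
    (D : set H) (M : R) : set H :=
  [set f | exists (psi : nat -> H) (c : nat -> R[i]),
     [/\ forall k, D (psi k),
         series (fun k => c k *: psi k) @ \oo --> f
       & (\sum_(0 <= k <oo) (normR (c k))%:E <= M%:E)%E]].

(* The orthogonal projection of x onto the subspace S: the point p of S with
   x - p orthogonal to S.  Such a p is unique, and it exists when S is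
   finite-dimensional; the value is 0 by default when it does not exist. *)
Definition orthoproj (R : realType) (H : completeNormedModType R[i])
    (ip : {dot H for (conjC : R[i] -> R[i])}) (S : set H) (x : H) : H :=
  xget 0 [set p | S p /\ forall y, S y -> ip (x - p) y = 0].

Section WOGA.
Variables (R : realType) (H : completeNormedModType R[i]).
Variable ip : {dot H for (conjC : R[i] -> R[i])}.

(* Selections psi, steps k and remainders are indexed from 1:
   the value psi 0 is never used. *)

(* H_k = span {psi_1, ..., psi_k}. *)
Definition woga_space (psi : nat -> H) (k : nat) : set H :=
  lspan [set x | exists2 j, (1 <= j <= k)%N & x = psi j].

Definition woga_res (psi : nat -> H) (k : nat) : H :=
  psi k - orthoproj ip (woga_space psi k.-1) (psi k).

Definition woga_v (psi : nat -> H) (k : nat) : R := normR (woga_res psi k).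

Definition woga_u (psi : nat -> H) (k : nat) : H :=
  (woga_v psi k)^-1%:C *: woga_res psi k.

(* f_k = f - sum_(l = 1)^(k - 1) <f, u_l> u_l, so that f_1 = f. *)
Definition woga_rem (f : H) (psi : nat -> H) (k : nat) : H :=
  f - \sum_(1 <= l < k) ip f (woga_u psi l) *: woga_u psi l.

(* The selection rule is imposed only while the remainder is nonzero: the
   algorithm stops at the first k with f_k = 0. *)
Definition woga_realization (D : set H) (t : nat -> R) (f : H)
    (psi : nat -> H) : Prop :=
  forall k, (1 <= k)%N -> woga_rem f psi k <> 0 ->
    D (psi k) /\
    normR (ip (woga_rem f psi k) (psi k)) >=
      t k * sup [set normR (ip (woga_rem f psi k) phi) | phi in D].

End WOGA.

(* Main.v *)
Require Import Defs.
From mathcomp Require Import all_boot all_order all_algebra sesquilinear.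
From mathcomp Require Import all_classical all_reals all_analysis.
From mathcomp Require Import complex.
From mathcomp Require Import ring lra.

(** The remainder f_k is orthogonal to H_{k-1}, so <f_k, f> = ||f_k||^2; expanding
    f in the dictionary gives ||f_k||^2 <= M s_k with s_k = sup |<f_k, psi>|.
    Passing to f_{k+1} subtracts from f_k its projection on the line of
    r_k = psi_k - P(psi_k), and <f_k, r_k> = <f_k, psi_k>, hence
    ||f_{k+1}||^2 = ||f_k||^2 - (|<f_k, psi_k>| / v_k)^2
                 <= ||f_k||^2 - (t_k ||f_k||^2 / (v_k M))^2,
    a recursion that forces ||f_n||^2 (1 + sum_{k<n} (t_k / v_k)^2) <= M^2. *)

Set Implicit Arguments.
Unset Strict Implicit.
Unset Printing Implicit Defensive.

Import Order.TTheory GRing.Theory Num.Theory Num.Def.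
Import numFieldNormedType.Exports.

Local Open Scope classical_set_scope.
Local Open Scope complex_scope.
Local Open Scope ring_scope.

(** * Real-valued norms over the complex scalars *)

Section NormR.
Variables (R : realType) (V : normedZmodType R[i]).
Implicit Types x y : V.

Lemma normRC x : (normR x)%:C = `|x|.
Proof. exact/RRe_real/normr_real. Qed.

Lemma normR_ge0 x : 0 <= normR x.
Proof. by rewrite -ler0c normRC. Qed.

Lemma normRD x y : normR (x + y) <= normR x + normR y.
Proof. by rewrite -lecR rmorphD /= !normRC ler_normD. Qed.

Lemma normR_sum n (F : nat -> V) :
  normR (\sum_(0 <= k < n) F k) <= \sum_(0 <= k < n) normR (F k).
Proof.
rewrite -lecR rmorph_sum normRC /=; apply: le_trans (ler_norm_sum _ _ _) _.
by rewrite (eq_bigr (fun k => (normR (F k))%:C)) // => k _; rewrite normRC.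
Qed.
End NormR.

Lemma normRM (R : realType) (a b : R[i]) : normR (a * b) = normR a * normR b.
Proof. by apply: complexI; rewrite rmorphM /= !normRC normrM. Qed.

Lemma normR_conjC (R : realType) (a : R[i]) : normR a^*%R = normR a.
Proof. by rewrite /normR norm_conjC. Qed.

(** * Linear spans *)

Section Span.
Variables (K : numFieldType) (V : lmodType K).
Implicit Types A B : set V.

Lemma sub_lspan A : A `<=` lspan A.
Proof.
move=> x Ax; exists 1%N, (fun=> 1), (fun=> x); split => //.
by rewrite big_ord1 scale1r.
Qed.

Lemma lspan0 A : lspan A 0.
Proof.
exists 0%N, (fun=> 0), (fun=> 0); split; first by case.
by rewrite big_ord0.
Qed.

Lemma lspanS A B : A `<=` B -> lspan A `<=` lspan B.
Proof.
by move=> AB x [n [a [y [Ay ->]]]]; exists n, a, y; split=> // i; apply: AB.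
Qed.

Lemma lspanZ A c x : lspan A x -> lspan A (c *: x).
Proof.
move=> [n [a [y [Ay ->]]]]; exists n, (fun i => c * a i), y; split=> //.
by rewrite scaler_sumr; apply: eq_bigr => i _; rewrite scalerA.
Qed.

Lemma lspanD A x y : lspan A x -> lspan A y -> lspan A (x + y).
Proof.
move=> [n [a [u [Au ->]]]] [m [b [v [Av ->]]]].
exists (n + m)%N, (fun i : 'I_(n + m) =>
    match fintype.split i with inl j => a j | inr j => b j end),
  (fun i : 'I_(n + m) =>
    match fintype.split i with inl j => u j | inr j => v j end); split.
  by move=> i; case: (fintype.split i).
rewrite big_split_ord /=; congr (_ + _); apply: eq_bigr => i _.
  by rewrite (unsplitK (inl i)).
by rewrite (unsplitK (inr i)).
Qed.

Lemma lspanB A x y : lspan A x -> lspan A y -> lspan A (x - y).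
Proof. by move=> Ax /(lspanZ (-1)); rewrite scaleN1r; exact: lspanD. Qed.
End Span.

(** * Residuals along a line, Cauchy-Schwarz, and pairing with [sparse_class] *)

Section InnerProduct.
Variables (R : realType) (H : completeNormedModType R[i]).
Variable ip : {dot H for (conjC : R[i] -> R[i])}.
Implicit Types (x y z : H) (S A : set H).

Definition ortho_to x S := forall y, S y -> ip x y = 0.

Lemma ortho_lspan x A : ortho_to x A -> ortho_to x (lspan A).
Proof.
move=> xA z [n [a [y [Ay ->]]]]; rewrite linear_sumr big1 // => i _.
by rewrite linearZr_LR /= xA // mulr0.
Qed.

(* The value is x when y = 0, division by 0 being 0. *)
Definition line_res x y := x - (ip x y / ip y y) *: y.

Lemma ip_line_res x y : ip (line_res x y) y = 0.
Proof.
rewrite /line_res linearBl linearZl_LR /=.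
have [->|y0] := eqVneq y 0; first by rewrite !linear0r subr0.
by rewrite divfK ?subrr // dnorm_eq0.
Qed.

Lemma ortho_line_res x y S :
  ortho_to x S -> ortho_to y S -> ortho_to (line_res x y) S.
Proof.
by move=> xS yS z Sz; rewrite linearBl linearZl_LR /= xS // (yS z Sz) mulr0 subr0.
Qed.

Hypothesis ip_norm : induces_norm ip.

Lemma normR_sqr x : (normR x ^+ 2)%:C = ip x x.
Proof. by rewrite rmorphXn /= normRC. Qed.

Lemma normR_ip_self x : normR (ip x x) = normR x ^+ 2.
Proof. by apply: complexI; rewrite normRC normR_sqr ger0_norm ?dnorm_ge0. Qed.

(** Pythagoras: what is left of [x] is orthogonal to the removed multiple of [y]. For [y = 0] both
    quotients are 0. *)
Lemma normR_line_res x y :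
  normR (line_res x y) ^+ 2 = normR x ^+ 2 - (normR (ip x y) / normR y) ^+ 2.
Proof.
apply: complexI; rewrite rmorphB /= !normR_sqr expr_div_n fmorph_div /=.
(* Only the second argument is expanded: its [y] component pairs to 0 with the residual, which
   leaves the pairing with [x]. *)
rewrite normR_sqr rmorphXn /= normRC {2}/line_res linearBr linearZr_LR /=.
rewrite ip_line_res mulr0 subr0 /line_res linearBl linearZl_LR /=.
rewrite [ip y x]hermC /= expr0 mul1r normCK mulrAC //.
Qed.

(** Pythagoras together with the nonnegativity of the squared norm of [line_res x y]. *)
Lemma cauchy_schwarz x y : normR (ip x y) <= normR x * normR y.
Proof.
have [->|y0] := eqVneq y 0.
  by rewrite linear0r /normR !normr0 mulr0.
have y_gt0 : 0 < normR y by rewrite -ltcR normRC normr_gt0.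
rewrite -ler_pdivrMr // -(@ler_pXn2r _ 2) ?nnegrE ?divr_ge0 ?normR_ge0 //.
by rewrite -subr_ge0 -normR_line_res sqr_ge0.
Qed.

(** The triangle inequality bounds the pairing of [x] with each partial sum of the expansion of [f];
    Cauchy-Schwarz carries the bound to the limit. *)
Lemma sparse_class_ip (D : set H) M f x s : 0 <= s ->
  sparse_class D M f -> (forall phi, D phi -> normR (ip x phi) <= s) ->
  normR (ip x f) <= M * s.
Proof.
move=> s_ge0 [psi [c [Dpsi psif cM]]] xs.
pose S n := \sum_(0 <= k < n) c k *: psi k.
have xS n : normR (ip x (S n)) <= M * s.
  rewrite linear_sumr; apply: le_trans (normR_sum _ _) _.
  apply: (@le_trans _ _ (\sum_(0 <= k < n) normR (c k) * s)).
    apply: ler_sum => k _; rewrite linearZr_LR /= normRM normR_conjC.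
    by apply: ler_wpM2l; [exact: normR_ge0 | exact: xs].
  rewrite -mulr_suml ler_wpM2r // -lee_fin; apply: le_trans cM.
  rewrite -sumEFin; apply: nneseries_lim_ge => k _.
  by rewrite lee_fin normR_ge0.
apply/ler_addgt0Pr => e e_gt0.
(* A tail of norm below this contributes at most [e] after pairing with [x]; the [+ 1] covers
   [x = 0]. *)
have d_gt0 : 0 < e / (normR x + 1).
  by rewrite divr_gt0 // ltr_wpDl ?normR_ge0.
have {}d_gt0 : 0 < (e / (normR x + 1))%:C by rewrite ltcR.
have /cvgrPdist_lt/(_ _ d_gt0)[N _ /(_ N (leqnn N))] := psif.
rewrite seriesEnat /= -normRC ltcR => fN.
rewrite -(subrK (S N) f) linearDr addrC; apply: le_trans (normRD _ _) _.
apply: lerD; first exact: xS.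
apply: le_trans (cauchy_schwarz _ _) _.
apply: (@le_trans _ _ ((normR x + 1) * (e / (normR x + 1)))).
  by apply: ler_pM; rewrite ?normR_ge0 ?lerDl ?ltW.
by rewrite mulrC divfK // gt_eqF // ltr_wpDl ?normR_ge0.
Qed.
(** Pairing [f] with itself, with [s = normR f], gives ||f||^2 <= M ||f||. *)
Lemma normR_sparse_class (D : set H) M f :
  0 < M -> dictionary D -> sparse_class D M f -> normR f <= M.
Proof.
move=> M_gt0 [D1 _] fDM; have := normR_ge0 f.
rewrite le_eqVlt => /orP[/eqP <-|f_gt0]; first exact: ltW.
rewrite -(ler_pM2r f_gt0) -expr2 -normR_ip_self.
apply: sparse_class_ip (ltW f_gt0) fDM _ => phi Dphi.
by apply: le_trans (cauchy_schwarz _ _) _; rewrite (D1 _ Dphi) mulr1.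
Qed.
End InnerProduct.

(** * Existence of orthogonal projections *)

Section Projection.
Variables (R : realType) (H : completeNormedModType R[i]).
Variable ip : {dot H for (conjC : R[i] -> R[i])}.
Implicit Types (x y z : H) (S A : set H).

Lemma ipBr_ortho x y z : ip x z = 0 -> ip x y = ip x (y - z).
Proof. by move=> xz; rewrite linearBr /= xz subr0. Qed.

(** [orthoproj] defaults to 0 when no projection exists, so its characteristic property is derived
    from this existence statement. *)
Definition has_proj S := forall x, exists p, S p /\ ortho_to ip (x - p) S.

Lemma orthoprojP S x : has_proj S ->
  S (orthoproj ip S x) /\ ortho_to ip (x - orthoproj ip S x) S.
Proof. by move=> /(_ x) ex_p; apply: (xgetPex 0 ex_p). Qed.

(** A Gram-Schmidt step: [a - q] is orthogonal to the span of [A], so the new projection is [p] plus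
    the component of [x - p] along [a - q]. If [a] already lies in the span, that component is 0. *)
Lemma has_proj_setU1 A a : has_proj (lspan A) -> has_proj (lspan (a |` A)).
Proof.
move=> projA; have [q [Aq aqA]] := projA a.
have sub : lspan A `<=` lspan (a |` A) by apply: lspanS => y; right.
have aqU : lspan (a |` A) (a - q).
  by apply: lspanB; [apply: sub_lspan; left | exact: sub].
move=> x; have [p [Ap xpA]] := projA x.
exists (p + (ip (x - p) (a - q) / ip (a - q) (a - q)) *: (a - q)); split.
  by apply: lspanD; [exact: sub | exact: lspanZ].
rewrite opprD addrA -/(line_res ip (x - p) (a - q)).
have resA := ortho_line_res xpA aqA.
apply: ortho_lspan => y [->|Ay]; last exact/resA/sub_lspan.
by rewrite (ipBr_ortho _ (resA q Aq)) ip_line_res.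
Qed.
End Projection.

(** * Geometry of the greedy remainders *)

Section WOGATheory.
Variables (R : realType) (H : completeNormedModType R[i]).
Variable ip : {dot H for (conjC : R[i] -> R[i])}.
Hypothesis ip_norm : induces_norm ip.
Variables (f : H) (psi : nat -> H).
Implicit Types k l : nat.

Local Notation space := (woga_space psi).
Local Notation res := (woga_res ip psi).
Local Notation v := (woga_v ip psi).
Local Notation u := (woga_u ip psi).
Local Notation rem := (woga_rem ip f psi).

Lemma woga_space_le k l : (k <= l)%N -> space k `<=` space l.
Proof.
move=> kl; apply: lspanS => x [j /andP[j1 jk] ->]; exists j => //.
by rewrite j1 (leq_trans jk).
Qed.

Lemma woga_space_psi k : (1 <= k)%N -> space k (psi k).
Proof. by move=> k1; apply: sub_lspan; exists k => //; rewrite k1 /=. Qed.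

Lemma has_proj_woga_space k : has_proj ip (space k).
Proof.
elim: k => [|k IHk].
  move=> x; exists 0; split; first exact: lspan0.
  by apply: ortho_lspan => y [[|j]].
rewrite /woga_space; have -> : [set x | exists2 j, (1 <= j <= k.+1)%N & x = psi j] =
      psi k.+1 |` [set x | exists2 j, (1 <= j <= k)%N & x = psi j].
  apply/seteqP; split=> [x [j /andP[j1]]|x [->|[j /andP[j1 jk] ->]]] /=.
  - rewrite leq_eqVlt ltnS => /orP[/eqP -> ->|jk ->]; first by left.
    by right; exists j => //; rewrite j1.
  - by exists k.+1 => //=.
  - by exists j => //; rewrite j1 leqW.
exact: has_proj_setU1.
Qed.

Lemma woga_projP k :
  space k.-1 (psi k - res k) /\ ortho_to ip (res k) (space k.-1).
Proof.
have [pS rS] := orthoprojP (psi k) (has_proj_woga_space k.-1).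
by split=> //; rewrite opprB addrC subrK.
Qed.

Lemma woga_space_u k : (1 <= k)%N -> space k (u k).
Proof.
move=> k1; apply: lspanZ; have [pS _] := woga_projP k.
rewrite -[res k](subKr (psi k)); apply: lspanB; first exact: woga_space_psi.
exact: (woga_space_le (leq_pred k)).
Qed.

Lemma woga_space_rem k : (1 <= k)%N -> space k.-1 (f - rem k).
Proof.
move=> k1; rewrite /woga_rem subKr big_nat_cond.
apply: big_rec => [|l y /andP[/andP[l1 lk] _] Sy]; first exact: lspan0.
apply: lspanD => //; apply: lspanZ.
by apply: woga_space_le (woga_space_u l1); rewrite -ltnS prednK.
Qed.

(* This holds even when the selected element lies in the previous space: then
   res k, u k and the junk quotient are all 0. *)
Lemma woga_remS k : (1 <= k)%N -> rem k.+1 = line_res ip (rem k) (res k).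
Proof.
move=> k1; rewrite /woga_rem big_nat_recr //= opprD addrA -/(rem k).
have [_ resS] := woga_projP k.
have fres : ip f (res k) = ip (rem k) (res k).
  apply/eqP; rewrite -subr_eq0 -linearBl herm_eq0C.
  by apply/eqP/resS; exact: woga_space_rem.
congr (_ - _); rewrite /woga_u linearZr_LR /= scalerA fres; congr (_ *: _).
(* The factor [(v k)^-1] of [u k] comes out of the second argument conjugated, but it is real; its
   square is the inverse of [ip (res k) (res k)]. *)
rewrite conj_Creal; last by apply/complex_realP; exists (v k)^-1.
rewrite -(normR_sqr ip_norm (res k)) -/(v k).
rewrite [_ * ip _ _]mulrC -mulrA -rmorphM -fmorphV /=.
by rewrite -expr2 exprVn.
Qed.

(** By induction: removing the [res k] component keeps orthogonality to the old space, and [psi k]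
    differs from [res k] by an element of that space. *)
Lemma woga_rem_ortho k : (1 <= k)%N -> ortho_to ip (rem k) (space k.-1).
Proof.
elim: k => // -[|k] IHk _.
  rewrite /woga_rem big_geq //= subr0.
  by apply: ortho_lspan => y [[|j]].
rewrite woga_remS //; have [pS rS] := woga_projP k.+1.
have resS := ortho_line_res (IHk isT) rS.
apply: ortho_lspan => y [j /andP[j1]]; rewrite leq_eqVlt => /orP[/eqP -> ->|jk ->].
  by rewrite (ipBr_ortho _ (resS _ pS)) subKr ip_line_res.
by apply: resS; apply: sub_lspan; exists j => //; rewrite j1.
Qed.

Lemma ip_woga_rem_psi k : (1 <= k)%N -> ip (rem k) (psi k) = ip (rem k) (res k).
Proof.
move=> k1; have [pS _] := woga_projP k.
by rewrite (ipBr_ortho _ (woga_rem_ortho k1 pS)) subKr.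
Qed.

Lemma ip_woga_rem k : (1 <= k)%N -> ip (rem k) f = ip (rem k) (rem k).
Proof.
move=> k1.
by rewrite (ipBr_ortho _ (woga_rem_ortho k1 (woga_space_rem k1))) subKr.
Qed.

Lemma normR_woga_remS k : (1 <= k)%N -> normR (rem k.+1) ^+ 2 =
  normR (rem k) ^+ 2 - (normR (ip (rem k) (psi k)) / v k) ^+ 2.
Proof. by move=> k1; rewrite woga_remS // normR_line_res // ip_woga_rem_psi. Qed.

(** Orthogonality turns the squared norm of [rem k] into its pairing with [f], which the expansion
    of [f] bounds. *)
Lemma normR_woga_rem_le_sup (D : set H) M k : (1 <= k)%N -> dictionary D ->
  sparse_class D M f ->
  normR (rem k) ^+ 2 <= M * sup [set normR (ip (rem k) phi) | phi in D].
Proof.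
move=> k1 [D1 _] fDM; set E := [set _ | _ in _].
(* Boundedness makes [sup E] a genuine upper bound rather than a default value. *)
have Eub : has_ubound E.
  exists (normR (rem k)) => _ [phi Dphi <-].
  by apply: le_trans (cauchy_schwarz ip_norm _ _) _; rewrite (D1 _ Dphi) mulr1.
have Esup phi : D phi -> normR (ip (rem k) phi) <= sup E.
  by move=> Dphi; apply: ub_le_sup => //; exists phi.
(* The expansion of [f] supplies an element of [D], whence [sup E] is nonnegative. *)
have [q [_ [Dq _ _]]] := fDM.
have E0 : 0 <= sup E by apply: le_trans (Esup _ (Dq 0%N)); exact: normR_ge0.
have := sparse_class_ip ip_norm E0 fDM Esup.
by rewrite ip_woga_rem // normR_ip_self.
Qed.
End WOGATheory.

(* With x = a / M^2, the claim b <= M^2 / (S + q^2) reduces to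
   x (1 - q^2 x) (S + q^2) <= (1 - q^2 x) (1 + q^2 x) <= 1. *)
Lemma greedy_step (R : realFieldType) (a b q S M : R) :
  0 < M -> 0 <= a -> 0 < S -> a * S <= M ^+ 2 -> b <= a - (q * a / M) ^+ 2 ->
  b * (S + q ^+ 2) <= M ^+ 2.
Proof.
move=> M0 a0 S0 aS bq.
have q0 : 0 <= q ^+ 2 := sqr_ge0 q.
have M20 : 0 < M ^+ 2 by rewrite exprn_gt0.
pose x := a / M ^+ 2.
have ax : a = x * M ^+ 2 by rewrite divfK // gt_eqF.
have x0 : 0 <= x by rewrite divr_ge0 // ltW.
have xS : x * S <= 1 by rewrite /x mulrAC ler_pdivrMr // mul1r.
apply: (@le_trans _ _ (M ^+ 2 * (x * (1 - q ^+ 2 * x) * (S + q ^+ 2)))).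
  rewrite mulrA ler_wpM2r ?addr_ge0 ?(ltW S0) //; apply: le_trans bq _.
  by rewrite ax le_eqVlt; apply/orP; left; apply/eqP; field; rewrite gt_eqF.
rewrite ger_pMr //.
set p := q ^+ 2 in q0 *.
(* The chain of inequalities multiplies by [1 - p * x], so it requires this sign; in the other case
   the left side is at most 0. *)
have [p1|p1] := leP 0 (1 - p * x).
  apply: (@le_trans _ _ ((1 - p * x) * (1 + p * x))); last first.
    by rewrite -subr_ge0; have := sqr_ge0 (p * x); nra.
  rewrite mulrAC [leLHS]mulrC ler_wpM2l //; nra.
have xp : 0 <= x * (S + p) by rewrite mulr_ge0 // addr_ge0 // ltW.
apply: (@le_trans _ _ 0) => //; rewrite mulrAC.
by rewrite mulr_ge0_le0 // ltW.
Qed.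

(** * Induction along the steps of the algorithm *)

Theorem mainTheorem1 (R : realType) (H : completeNormedModType R[i])
    (ip : {dot H for (conjC : R[i] -> R[i])}) (ip_norm : induces_norm ip)
    (D : set H) (D_dict : dictionary D)
    (M : R) (M_gt0 : 0 < M) (f : H) (fDM : sparse_class D M f)
    (t : nat -> R) (t01 : forall k, (1 <= k)%N -> 0 < t k <= 1)
    (psi : nat -> H) (psi_woga : woga_realization ip D t f psi)
    (n : nat) (n_ge1 : (1 <= n)%N)
    (rem_neq0 : forall k, (1 <= k < n)%N -> woga_rem ip f psi k <> 0) :
  normR (woga_rem ip f psi n) <=
    M * (1 + \sum_(1 <= k < n) (t k / woga_v ip psi k) ^+ 2) `^ (- 2^-1).
Proof.
pose S m := 1 + \sum_(1 <= k < m) (t k / woga_v ip psi k) ^+ 2.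
have S_gt0 m : 0 < S m by rewrite ltr_wpDr // sumr_ge0 // => k _; exact: sqr_ge0.
(* Squared form of the claim, with the index shifted so that the induction starts at the first
   remainder [f]. *)
suff bound m : (m < n)%N ->
    normR (woga_rem ip f psi m.+1) ^+ 2 * S m.+1 <= M ^+ 2.
  rewrite -/(S n) powRN powR12_sqrt ?(ltW (S_gt0 n)) // ler_pdivlMr ?sqrtr_gt0 //.
  rewrite -(@ler_pXn2r _ 2) ?nnegrE ?mulr_ge0 ?normR_ge0 ?sqrtr_ge0
    ?(ltW M_gt0) //.
  by rewrite exprMn sqr_sqrtr ?(ltW (S_gt0 n)) // -(prednK n_ge1) bound // prednK.
have sup_bound k (k1 : (1 <= k)%N) :=
  normR_woga_rem_le_sup ip_norm psi k1 D_dict fDM.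
elim: m => [_|m IHm mn].
  rewrite /S /woga_rem !big_geq // addr0 mulr1 subr0.
  by rewrite lerXn2r ?nnegrE ?normR_ge0 ?(ltW M_gt0)
    ?(normR_sparse_class ip_norm _ D_dict).
have fs := sup_bound m.+1 isT.
have /psi_woga[//|_ sel] := rem_neq0 _ (mn : (1 <= m.+1 < n)%N).
rewrite /S big_nat_recr //= addrA -/(S m.+1).
(* Here [a] and [b] are the squared norms of two consecutive remainders and [q = t / v]. *)
apply: greedy_step (IHm (ltnW mn)) _ => //; first exact: sqr_ge0.
rewrite normR_woga_remS // lerB // ler_sqr ?nnegrE; last 2 first.
- have /andP[/ltW t0 _] := t01 m.+1 isT.
  by rewrite !(mulr_ge0, invr_ge0) ?normR_ge0 ?sqr_ge0 // ltW.
- by rewrite divr_ge0 ?normR_ge0.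
have /andP[/ltW t0 _] := t01 m.+1 isT.
(* With the common factor [v^-1] set aside, it remains to chain [t * ||f_k||^2 <= t * M * sup] with
   the selection rule. *)
rewrite ler_pdivrMr // mulrAC [leRHS]mulrAC.
rewrite ler_wpM2r ?invr_ge0 ?normR_ge0 //; apply: le_trans (ler_wpM2l t0 fs) _.
by rewrite mulrCA [leRHS]mulrC ler_pM2l.
Qed.
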